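(* In the upper half-space model $\mathbb{H}^3=\{x_3>0\}$ with metric $\frac{1}{x_3^2}(dx_1^2+dx_2^2+dx_3^2)$, let $E$ be the end of revolution $\{(\gamma_1(s)\cos\theta,\gamma_1(s)\sin\theta,\gamma_2(s)): s\ge0,\theta\in[0,2\pi)\}$, where $\gamma(s)=(\gamma_1(s),0,\gamma_2(s))$, $s\in[0,\infty)$, is a regular curve parametrized by hyperbolic arc length with $\gamma_1>0$, $\gamma_2>0$. Suppose that for some $c>0$ the set $I_+=\{s\in[0,\infty): \gamma_2(s)/\gamma_1(s)\ge c\}$ satisfies $\int_{I_+}ds=\infty$. Then $E$ is parabolic.
   Context: $E$ carries the metric induced by the immersion $(s,\theta)\mapsto(\gamma_1(s)\cos\theta,\gamma_1(s)\sin\theta,\gamma_2(s))$. An end is parabolic if every bounded harmonic function on it is determined by its boundary values. *)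

(* Defs.v *)
From HB Require Import structures.
From mathcomp Require Import all_boot all_order all_algebra.
From mathcomp Require Import all_classical all_reals all_analysis.
Set Implicit Arguments. Unset Strict Implicit. Unset Printing Implicit Defensive.
Import Order.TTheory GRing.Theory Num.Theory.
Import numFieldNormedType.Exports.
Local Open Scope classical_set_scope.
Local Open Scope ring_scope.

Section EndOfRevolution.
Variable R : realType.

(* Profile curve gamma(s) = (g1 s, 0, g2 s), s in [0, +oo), in the upper
   half-space model of H^3: a C^1 curve with g1, g2 > 0, parametrized by
   hyperbolic arc length: (g1'^2 + g2'^2) / g2^2 = 1. *)
Definition profile_curve (g1 g2 : R -> R) : Prop :=
  [/\ (forall s, 0 <= s -> 0 < g1 s /\ 0 < g2 s),
      {within `[0, +oo[, continuous g1},
      {within `[0, +oo[, continuous g2},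
      (forall s, 0 < s ->
         [/\ derivable g1 s 1, derivable g2 s 1,
             {for s, continuous (derive1 g1)} & {for s, continuous (derive1 g2)}]) &
      (forall s, 0 < s -> (derive1 g1) s ^+ 2 + (derive1 g2) s ^+ 2 = g2 s ^+ 2)].

(* The induced metric of (s,theta) |-> (g1 cos, g1 sin, g2) is
   ds^2 + rho(s)^2 dtheta^2 with rho = g1/g2. *)
Definition rho (g1 g2 : R -> R) (s : R) : R := g1 s / g2 s.

Definition ps (u : R -> R -> R) : R -> R -> R :=
  fun s t => derive1 (fun x => u x t) s.
Definition pt (u : R -> R -> R) : R -> R -> R :=
  fun s t => derive1 (fun y => u s y) t.

Definition uncurry2 (u : R -> R -> R) : R * R -> R := fun p => u p.1 p.2.

Definition C2_at (u : R -> R -> R) (s t : R) : Prop :=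
  [/\ derivable (fun x => u x t) s 1, derivable (fun y => u s y) t 1,
      (forall w, w = ps u \/ w = pt u ->
          derivable (fun x => w x t) s 1 /\ derivable (fun y => w s y) t 1),
      [/\ {for (s, t), continuous (uncurry2 (ps (ps u)))},
          {for (s, t), continuous (uncurry2 (pt (ps u)))},
          {for (s, t), continuous (uncurry2 (ps (pt u)))},
          {for (s, t), continuous (uncurry2 (pt (pt u)))} &
          {for (s, t), continuous (uncurry2 (ps u))}] &
      {for (s, t), continuous (uncurry2 (pt u))}].

(* Laplace-Beltrami operator of ds^2 + rho^2 dtheta^2 in coordinates *)
Definition laplacian (g1 g2 : R -> R) (u : R -> R -> R) (s t : R) : R :=
  derive1 (fun x => rho g1 g2 x * ps u x t) s / rho g1 g2 s
  + pt (pt u) s t / (rho g1 g2 s) ^+ 2.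

(* A bounded harmonic function on the end E = [0,+oo) x S^1 (functions of
   (s,theta), 2pi-periodic in theta), continuous up to the boundary s = 0
   and harmonic (C^2, Laplacian zero) in the interior s > 0. *)
Definition bounded_harmonic_on_end (g1 g2 : R -> R) (u : R -> R -> R) : Prop :=
  [/\ (forall s t, u s (t + 2 * pi) = u s t),
      {within [set p : R * R | 0 <= p.1], continuous (uncurry2 u)},
      (forall s t, 0 < s -> C2_at u s t /\ laplacian g1 g2 u s t = 0) &
      (exists M : R, forall s t, 0 <= s -> `|u s t| <= M)].

Definition parabolic_end (g1 g2 : R -> R) : Prop :=
  forall u v : R -> R -> R,
    bounded_harmonic_on_end g1 g2 u -> bounded_harmonic_on_end g1 g2 v ->
    (forall t, u 0 t = v 0 t) ->
    forall s t, 0 <= s -> u s t = v s t.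

End EndOfRevolution.

(* Main.v *)
(** The induced metric is [ds^2 + rho^2 dtheta^2] with [rho = g1 / g2], so the
    primitive [h] of [1 / rho] vanishing at [0] is harmonic, and it is unbounded
    because [1 / rho >= c] on a set of infinite measure.  If [u - v] were positive
    somewhere, then for small [e, dl > 0] and large [S] the function
    [u - v - e h + dl h^2] would reach its maximum over [0 <= s <= S] at an
    interior point; there it is strictly subharmonic, since
    [(rho (h^2)')' = 2 / rho > 0], a contradiction. *)
Require Import Defs.
From HB Require Import structures.
From mathcomp Require Import all_boot all_order all_algebra.
From mathcomp Require Import all_classical all_reals all_analysis.
From mathcomp Require Import measurable_realfun lra ring.
Set Implicit Arguments. Unset Strict Implicit. Unset Printing Implicit Defensive.
Import Order.TTheory GRing.Theory Num.Theory.
Import numFieldNormedType.Exports.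
Local Open Scope classical_set_scope.
Local Open Scope ring_scope.

(** * One-variable calculus: a flux form of the second derivative test, and unbounded primitives *)

Section RealFunctions.
Variable R : realType.
Implicit Types (f k p q : R -> R).
Local Notation mu := (@lebesgue_measure R).

(** At the maximum [f' = 0], so the flux [p = k f'] vanishes there. If [D > 0], then [p], hence
    [f'], is positive just to the right of [x], and [f] rises above its maximum. The weight [k] lets
    one statement serve both directions: [k = rho] along [s] and [k = 1] along [theta]. *)
Lemma local_max_flux_derive_le0 f df k p (a b x D : R) : x \in `]a, b[ ->
  (forall y, y \in `]a, b[ -> is_derive y 1 f (df y)) ->
  (forall y, y \in `]a, b[ -> 0 < k y /\ p y = k y * df y) ->
  is_derive x 1 p D ->
  (forall y, y \in `]a, b[ -> f y <= f x) ->
  D <= 0.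
Proof.
move=> xab fdf kp pD fmax; rewrite leNgt; apply/negP => D0.
have [ax xb] : a < x /\ x < b by move: xab; rewrite in_itv /= => /andP[].
have dfx0 : df x = 0.
  have fx0 : is_derive x 1 f 0.
    apply: (@derive1_at_max _ _ a b) => //; first exact/ltW/(lt_trans ax).
    by move=> t /fdf [].
  by have := fdf _ xab => -[_ <-]; have [_ ->] := fx0.
have px0 : p x = 0 by have [_ ->] := kp _ xab; rewrite dfx0 mulr0.
(* Caratheodory form: [p z - p x = g z * (z - x)] with [g] continuous at [x] and [g x = D], so the
   sign of [p] to the right of [x] is that of [g]. *)
have [g [pg gc gx]] := (is_derive1_caratheodory p x D).1 pD.
have : \forall z \near x, 0 < g z by apply: cvgr_gt gc _ _; rewrite gx.
move=> /nbhs_ballP [e /= e0 ge].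
pose d := Num.min (x + e / 2) ((x + b) / 2).
have xd : x < d by rewrite lt_min; apply/andP; split; lra.
have db : d < b by rewrite gt_min; apply/orP; right; lra.
have de : d < x + e by rewrite gt_min; apply/orP; left; lra.
have sub y : x <= y <= d -> y \in `]a, b[.
  move=> /andP[xy yd]; rewrite in_itv /=; apply/andP; split; lra.
have fd y : y \in `]x, d[ -> is_derive y 1 f (df y).
  by rewrite in_itv /= => /andP[xy yd]; apply/fdf/sub; rewrite !ltW.
have fc : {within `[x, d], continuous f}.
  by apply: derivable_within_continuous => y; rewrite in_itv /= => /sub /fdf [].
have [c cxd fe] := MVT xd fd fc.
move: cxd; rewrite in_itv /= => /andP[xc cd].
have cab : c \in `]a, b[ by apply: sub; rewrite !ltW.
have [kc pc] := kp _ cab.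
have dfc : 0 < df c.
  have pcg : p c = g c * (c - x) by rewrite -pg px0 subr0.
  rewrite -(pmulr_rgt0 _ kc) -pc pcg mulr_gt0 ?subr_gt0//.
  by apply: ge; rewrite /ball /= ltr0_norm; lra.
have := fmax d (sub d _); rewrite lexx ltW// => /(_ isT) fdx.
have : 0 < df c * (d - x) by rewrite mulr_gt0 ?subr_gt0.
by rewrite -fe; lra.
Qed.

(** Take [h x] to be the integral of [q] from [0] to [x]. Then [h n] is at least [c] times the
    measure of the part of the set in [[0, n]], which tends to infinity with [n]. *)
Lemma exists_unbounded_primitive q (c : R) :
  continuous q -> (forall x, 0 <= q x) -> 0 < c ->
  @lebesgue_measure R [set s : R | 0 <= s /\ c <= q s] = +oo%E ->
  exists h : R -> R, [/\ h 0 = 0, forall x : R, 0 <= x -> is_derive x 1 h (q x) &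
    forall A b : R, exists2 x : R, b < x & A < h x].
Proof.
move=> qc q0 c0 Ioo.
set I := [set s : R | _] in Ioo.
have qi (a b : R) : mu.-integrable `[a, b] (EFin \o q).
  apply: continuous_compact_integrable; first exact: segment_compact.
  exact: continuous_subspaceT.
(* Integrating from [-1] makes [0] an interior point, so that the derivative at [0] is two-sided;
   subtracting [H 0] normalises. *)
pose H x := (\int[mu]_(t in `[-1, x]) q t)%R.
exists (fun x => H x - H 0); split.
- by rewrite subrr.
- move=> x x0.
  have [||||dH HE] := @continuous_FTC1_closed _ q (-1) x (x + 1); rewrite ?ltrDl//.
  + by rewrite (lt_le_trans _ x0)// ltrN10.
  + exact: qc.
  rewrite -[q x]subr0; apply: is_deriveB.
  by rewrite -HE derive1E; exact: derivableP.
- move=> A b.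
  have mI : measurable (I : set (measurableTypeR R)).
    rewrite (_ : I = `[0, +oo[ `&` q @^-1` `[c, +oo[); last first.
      by apply/seteqP; split=> x; rewrite /I /= !in_itv /= !andbT.
    apply: measurableI => //; apply: closed_measurable.
    apply: closed_comp; first by move=> x _; exact: qc.
    exact: interval_closed.
  pose In (n : nat) := I `&` `[0, n%:R].
  have mIn n : measurable (In n : set (measurableTypeR R)) by exact: measurableI.
  have IE : \bigcup_n In n = I.
    apply/seteqP; split=> [x [n _ []]//|x Ix].
    exists (Num.bound x) => //; split=> //=; rewrite in_itv /= Ix.1 /=.
    by rewrite ltW// archi_boundP//; case: Ix.
  have cv : (mu \o In) n @[n --> \oo] --> +oo%E.
    rewrite -Ioo -IE; apply: nondecreasing_cvg_mu => //; first by rewrite IE.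
    move=> m n mn; apply/subsetPset => x [Ix]; rewrite /= in_itv /= => /andP[x0 xm].
    by split=> //=; rewrite in_itv /= x0 (le_trans xm)// ler_nat.
  (* This threshold, multiplied by [c], leaves [H n] above [A + H 0] with a margin of [1]. *)
  have /cvgeyPge/(_ ((A + H 0 + 1) / c)) cvA := cv.
  have [n [nb nA]] : exists n : nat, b < n%:R /\ (((A + H 0 + 1) / c)%:E <= mu (In n))%E.
    have : \forall n \near \oo, b < n%:R /\ (((A + H 0 + 1) / c)%:E <= mu (In n))%E.
      apply: filter_app cvA; near=> n => ?; split => //; near: n.
      exact: nbhs_infty_gtr.
    by case=> N _ /(_ N (leqnn N)) ?; exists N.
  exists n%:R => //; rewrite ltrBrDr.
  suff : (A + H 0 + 1) <= H n%:R by lra.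
  (* The chain is: [c * mu (In n)] is the integral of [c] over [In n], at most that of [q] over
     [In n], at most that of [q >= 0] over [[-1, n]]. *)
  have : (c%:E * mu (In n) <= (H n%:R)%:E)%E.
    rewrite /H /Rintegral fineK; last exact: integrable_fin_num.
    have mq D : measurable_fun (D : set (measurableTypeR R)) (EFin \o q).
      apply/measurable_EFinP; apply: measurable_funTS.
      exact: continuous_measurable_fun.
    apply: (@le_trans _ _ (\int[mu]_(x in In n) (q x)%:E)%E).
      rewrite -(@integral_cst _ (measurableTypeR R) R mu)//.
      apply: (@ge0_le_integral _ (measurableTypeR R)) => //.
      + by move=> x _; rewrite /= lee_fin ltW.
      + by move=> x [[]]; rewrite /= lee_fin.
    apply: (@ge0_subset_integral _ (measurableTypeR R)) => //.
    + by move=> x _; rewrite /= lee_fin.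
    + move=> x [_]; rewrite /= !in_itv /= => /andP[x0 ->]; rewrite andbT.
      by rewrite (le_trans _ x0)// lerN10.
  have c0' : (0 <= c%:E)%E by rewrite lee_fin ltW.
  move=> /(le_trans (lee_wpmul2l c0' nA)).
  by rewrite -EFinM lee_fin mulrCA divff ?mulr1// gt_eqF.
Unshelve. all: by end_near. Qed.

End RealFunctions.

(** Used to extend the profile curve, continuous only on the half-line, to all of [R] by
    precomposing with a retraction onto the half-line. *)
Lemma within_continuous_comp_in (T U V : topologicalType) (A : set U)
    (f : U -> V) (g : T -> U) :
  {within A, continuous f} -> continuous g -> (forall x, A (g x)) ->
  continuous (f \o g).
Proof.
move=> fA gc gA x W Wfgx.
have : within A (nbhs (g x)) (f @^-1` W).
  by rewrite nbhs_subspace_in; [exact: fA Wfgx|exact: gA].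
move=> /(gc x) gW; change (nbhs x ((f \o g) @^-1` W)).
by move: gW; apply: (@filterS _ (nbhs x)) => y /=; apply; exact: gA.
Qed.

(** * Maxima of periodic functions on a strip *)

Section Periodic.
Variable R : realType.

Lemma periodicz (T : R) (f : R -> R) : periodic f T ->
  forall (n : int) (a : R), f (a + T *~ n) = f a.
Proof.
move=> fT [] n a; first by rewrite -pmulrn periodicn.
by rewrite NegzE mulrNz -pmulrn -[LHS](periodicn fT n.+1) subrK.
Qed.

(** One period of the strip is a compact rectangle, where the extreme value theorem applies. *)
Lemma periodic_strip_max (F : R -> R -> R) (S T : R) : 0 <= S -> 0 < T ->
  (forall s, periodic (F s) T) ->
  {within [set p : R * R | 0 <= p.1], continuous (uncurry2 F)} ->
  exists s0 t0, 0 <= s0 <= S /\ forall s t, 0 <= s <= S -> F s t <= F s0 t0.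
Proof.
move=> S0 T0 FT Fc.
have [|||c] := @compact_EVT_max (R * R)%type R (uncurry2 F) (`[0, S] `*` `[0, T]).
- by exists (0, 0); split; rewrite /= in_itv /= lexx// ltW.
- by apply: compact_setX; exact: segment_compact.
- by apply: continuous_subspaceW Fc => -[x y] [] /=; rewrite in_itv /= => /andP[].
case: c => s0 t0; rewrite inE => -[/=]; rewrite in_itv /= => s0S _ Fmax.
exists s0, t0; split=> // s t sS.
(* Removing [floor (t / T)] periods brings [t] into [[0, T]]. *)
rewrite -(periodicz (FT s) (- Num.floor (t / T)) t).
apply: (Fmax (s, t + T *~ - Num.floor (t / T))); rewrite inE; split=> //=.
rewrite in_itv /=; have /andP[] := floor_itv (t / T).
rewrite ler_pdivlMr// ltr_pdivrMr// intrD mulrDl mul1r mulrNz -mulrzl.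
by move=> ? ?; apply/andP; split; lra.
Qed.

End Periodic.

(** * Comparison of bounded harmonic functions by means of the barrier [h] *)

Section Comparison.
Variable R : realType.
Variables g1 g2 : R -> R.
Hypothesis g12 : profile_curve g1 g2.
Implicit Types (u v : R -> R -> R).
Local Notation rho := (rho g1 g2).

Lemma rho_gt0 s : 0 <= s -> 0 < rho s.
Proof. by case: g12 => + _ _ _ _ => /[apply] -[? ?]; rewrite divr_gt0. Qed.

Lemma derivable_rho s : 0 < s -> derivable rho s 1.
Proof.
case: g12 => gpos _ _ dg _ s0; have [d1 d2 _ _] := dg s s0.
have g2s : g2 s != 0 by case: (gpos _ (ltW s0)) => _ /gt_eqF ->.
exact: derivableM d1 (derivableV g2s d2).
Qed.

(** The last clause is the Laplace equation in flux form, the shape required by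
    [local_max_flux_derive_le0]. *)
Lemma harmonic_is_derive u (s t : R) : bounded_harmonic_on_end g1 g2 u -> 0 < s ->
  [/\ is_derive s 1 (u^~ t) (ps u s t), is_derive t 1 (u s) (pt u s t),
      is_derive t 1 (pt u s) (pt (pt u) s t) &
      is_derive s 1 (fun x => rho x * ps u x t) (- (pt (pt u) s t / rho s))].
Proof.
case=> _ _ /(_ s t) + _ s0 => /(_ s0) [[du1 du2 dw _ _] lap0].
have [d1 _] := dw _ (or_introl erefl); have [_ d2] := dw _ (or_intror erefl).
split.
- by rewrite /ps derive1E; exact: derivableP du1.
- by rewrite /pt derive1E; exact: derivableP du2.
- by rewrite [X in is_derive _ _ _ X]/pt derive1E; exact: derivableP d2.
have rs := rho_gt0 (ltW s0).
have -> : - (pt (pt u) s t / rho s) = derive1 (fun x => rho x * ps u x t) s.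
  rewrite -sub0r -[X in X - _](mulr0 (rho s)) -lap0 /laplacian.
  by field; rewrite gt_eqF.
rewrite derive1E.
exact: derivableP (derivableM (derivable_rho s0) d1).
Qed.

Lemma bounded_harmonic_le u v (h : R -> R) :
  h 0 = 0 -> (forall s : R, 0 <= s -> is_derive s 1 h (rho s)^-1) ->
  (forall A b : R, exists2 s : R, b < s & A < h s) ->
  bounded_harmonic_on_end g1 g2 u -> bounded_harmonic_on_end g1 g2 v ->
  (forall t, u 0 t = v 0 t) -> forall s t, 0 <= s -> u s t <= v s t.
Proof.
move=> h0 dh hoo hu hv uv0 s1 t1 s1_ge0; rewrite leNgt; apply/negP => vu1.
have s1_gt0 : 0 < s1.
  by rewrite lt_neqAle s1_ge0 andbT; apply: contraTneq vu1 => <-; rewrite uv0 ltxx.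
have [uT uc _ [Mu uM]] := hu; have [vT vc _ [Mv vM]] := hv.
pose d := u s1 t1 - v s1 t1.
have d0 : 0 < d by rewrite subr_gt0.
(* At [(s1, t1)] the barrier term costs at most [d / 2]; the [+ 1] keeps the denominator positive if
   [h s1 = 0]. *)
pose e := d / (2 * (`|h s1| + 1)).
have e0 : 0 < e by rewrite divr_gt0// mulr_gt0// ltr_wpDl.
have eh1 : e * h s1 <= d / 2.
  have -> : d / 2 = e * (`|h s1| + 1).
    by rewrite /e; field; rewrite gt_eqF// ltr_wpDl.
  by rewrite ler_pM2l// (le_trans (ler_norm _))// lerDl.
(* At [s = S] the barrier term [e * h S] exceeds [Mu + Mv], a bound for [u - v]. *)
have [S s1S] := hoo ((Mu + Mv) / e) s1; rewrite ltr_pdivrMr// => hS.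
have S0 : 0 < S by exact: lt_trans s1S.
(* Small enough that the convex correction at [s = S] stays below [d / 2], the lower bound for
   [F s1 t1]. *)
pose dl := d / (4 * (h S ^+ 2 + 1)).
have hS1 : 0 < h S ^+ 2 + 1 by rewrite ltr_wpDl// sqr_ge0.
have dl0 : 0 < dl by rewrite divr_gt0// mulr_gt0.
have dlh : dl * h S ^+ 2 < d / 2.
  have -> : d / 2 = dl * (2 * (h S ^+ 2 + 1)).
    by rewrite /dl; field; rewrite gt_eqF.
  by rewrite ltr_pM2l//; have := sqr_ge0 (h S); lra.
pose F s t := u s t - v s t - e * h s + dl * h s ^+ 2.
have F1 : d / 2 <= F s1 t1.
  have : 0 <= dl * h s1 ^+ 2 by rewrite mulr_ge0 ?sqr_ge0// ltW.
  by rewrite /F -/d; lra.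
have [||||s0 [t0 [s0S Fmax]]] := @periodic_strip_max R F S (2 * pi).
- exact: ltW.
- by rewrite mulr_gt0// pi_gt0.
- by move=> s t; rewrite /F uT vT.
- have -> : uncurry2 F = (uncurry2 u - uncurry2 v) +
      (fun p => - (e * h p.1) + dl * h p.1 ^+ 2).
    by apply/funext => -[s t]; rewrite /F /uncurry2 !fctE /= addrA.
  apply: within_continuousD; first exact: within_continuousB.
  apply: continuous_in_subspaceT => -[s t]; rewrite inE /= => s_ge0.
  pose k x := - (e * h x) + dl * h x ^+ 2.
  apply: (@continuous_comp _ _ _ fst k); first exact: cvg_fst.
  have dhs := dh s s_ge0.
  apply/differentiable_continuous/derivable1_diffP.
  by case: (is_deriveD (is_deriveN (is_deriveZ e dhs))
    (is_deriveZ dl (is_deriveX 2 dhs))).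
have Fs0 : F s1 t1 <= F s0 t0 by apply: Fmax; rewrite s1_ge0 ltW.
(* The maximum is at least [d / 2], whereas [F] vanishes at [s = 0] and is below [d / 2] at [s = S];
   hence it is attained in the interior. *)
have s0_gt0 : 0 < s0.
  case/andP: s0S; rewrite le_eqVlt => /predU1P[s00|//] _.
  by move: Fs0; rewrite -s00 {2}/F uv0 h0 subrr mulr0 subr0 expr0n /= mulr0; lra.
have s0_lt : s0 < S.
  case/andP: s0S => _; rewrite le_eqVlt => /predU1P[s00|//].
  have /ler_normlP[_ uS] := uM S t0 (ltW S0).
  have /ler_normlP[vS _] := vM S t0 (ltW S0).
  by move: Fs0; rewrite s00 {2}/F; lra.
have r0 := rho_gt0 (ltW s0_gt0).
have tt : pt (pt u) s0 t0 - pt (pt v) s0 t0 <= 0.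
  apply: (@local_max_flux_derive_le0 _ (F s0) (fun t => pt u s0 t - pt v s0 t)
    (fun=> 1) (fun t => pt u s0 t - pt v s0 t) (t0 - 1) (t0 + 1) t0).
  - by rewrite in_itv /=; apply/andP; split; lra.
  - move=> t _.
    have [_ du _ _] := harmonic_is_derive t hu s0_gt0.
    have [_ dv _ _] := harmonic_is_derive t hv s0_gt0.
    have dF := is_deriveD (is_deriveB (is_deriveB du dv)
      (is_derive_cst (e * h s0) t 1)) (is_derive_cst (dl * h s0 ^+ 2) t 1).
    by apply: (is_derive_eq dF); rewrite subr0 addr0.
  - by move=> t _; rewrite mul1r.
  - have [_ _ du _] := harmonic_is_derive t0 hu s0_gt0.
    have [_ _ dv _] := harmonic_is_derive t0 hv s0_gt0.
    exact: is_deriveB.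
  - by move=> t _; apply: Fmax; rewrite !ltW.
(* Since [rho * h' = 1], the flux [rho * F_s] is that of [u - v] minus the constant [e] plus
   [2 * dl * h]. The term [- 0] is the derivative of [e]. *)
have : - (pt (pt u) s0 t0 / rho s0) - - (pt (pt v) s0 t0 / rho s0) - 0
    + (2 * dl) * (rho s0)^-1 <= 0.
  apply: (@local_max_flux_derive_le0 _ (F^~ t0)
    (fun s => ps u s t0 - ps v s t0 - e * (rho s)^-1
              + dl * (2 * h s * (rho s)^-1)) rho
    (fun s => rho s * ps u s t0 - rho s * ps v s t0 - e + (2 * dl) * h s) 0 S s0).
  - by rewrite in_itv /= s0_gt0.
  - move=> s; rewrite in_itv /= => /andP[s_gt0 _].
    have [du _ _ _] := harmonic_is_derive t0 hu s_gt0.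
    have [dv _ _ _] := harmonic_is_derive t0 hv s_gt0.
    have dhs := dh s (ltW s_gt0).
    exact: is_deriveD (is_deriveB (is_deriveB du dv) (is_deriveZ e dhs))
      (is_deriveZ dl (is_deriveX 2 dhs)).
  - move=> s; rewrite in_itv /= => /andP[s_gt0 _].
    have rs := rho_gt0 (ltW s_gt0); split=> //.
    by field; rewrite gt_eqF.
  - have [_ _ _ du] := harmonic_is_derive t0 hu s0_gt0.
    have [_ _ _ dv] := harmonic_is_derive t0 hv s0_gt0.
    have dhs := dh s0 (ltW s0_gt0).
    exact: is_deriveD (is_deriveB (is_deriveB du dv) (is_derive_cst e s0 1))
      (is_deriveZ (2 * dl) dhs).
  - by move=> s; rewrite in_itv /= => /andP[? ?]; apply: Fmax; rewrite !ltW.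
(* The angular terms are nonpositive by [tt], so the previous inequality would force
   [2 * dl / rho <= 0]. *)
have : (pt (pt u) s0 t0 - pt (pt v) s0 t0) * (rho s0)^-1 <= 0.
  by rewrite mulr_le0_ge0// invr_ge0 ltW.
have : 0 < (2 * dl) * (rho s0)^-1 by rewrite mulr_gt0 ?invr_gt0// mulr_gt0.
lra.
Qed.

End Comparison.

(** * Construction of the barrier from the profile curve, and uniqueness by comparing in both
    directions *)

Theorem theorem4p1 (R : realType) (g1 g2 : R -> R) :
  profile_curve g1 g2 ->
  (exists2 c : R, 0 < c &
     @lebesgue_measure R [set s : R | 0 <= s /\ c <= g2 s / g1 s] = +oo%E) ->
  parabolic_end g1 g2.
Proof.
move=> g12 [c c0 Ioo] u v hu hv uv0.
have [gpos g1c g2c _ _] := g12.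
(* Clamping negative arguments to [0] gives a continuous [q] on all of [R] that equals [g2 / g1],
   that is [1 / rho], on the half-line. *)
pose m x : R := Num.max x 0.
have m_ge0 x : 0 <= m x by rewrite le_max lexx orbT.
have mE x : 0 <= x -> m x = x by move=> x0; rewrite /m max_l.
have mc : continuous m.
  move=> x; apply: (@continuous_max _ _ id (cst 0)); first exact: cvg_id.
  exact: cvg_cst.
have mA x : [set` `[0, +oo[] (m x) by rewrite /= in_itv /= m_ge0.
pose q x := g2 (m x) / g1 (m x).
have qc : continuous q.
  move=> x; apply: cvgM; first exact: (within_continuous_comp_in g2c mc mA).
  apply: cvgV; last exact: (within_continuous_comp_in g1c mc mA).
  by rewrite gt_eqF//; case: (gpos _ (m_ge0 x)).
have q0 x : 0 <= q x by case: (gpos _ (m_ge0 x)) => *; rewrite divr_ge0// ltW.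
have [|h [h0 dh hoo]] := exists_unbounded_primitive qc q0 c0.
  rewrite -Ioo; congr (_ _); apply/seteqP.
  by split=> s [s0 cs]; split=> //; move: cs; rewrite /q mE.
have dh' (s : R) : 0 <= s -> is_derive s 1 h (rho g1 g2 s)^-1.
  by move=> s0; rewrite /rho invf_div -{2 3}(mE s s0); exact: dh.
move=> s t s0; apply: le_anti; apply/andP; split.
  exact: (bounded_harmonic_le g12 h0 dh' hoo hu hv uv0).
by apply: (bounded_harmonic_le g12 h0 dh' hoo hv hu).
Qed.
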